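(* Let $n\geq 3$ be even. In $\mathbb S_{2n}$ let $t_i=(2i-1,\,2i)$ for $1\leq i\leq n$ and $H=\langle t_1,\dots,t_n\rangle\cong(\mathbb Z_2)^n$. Let $a_1,\dots,a_n\in\widehat H$ be defined by $a_i(t_j)=1$ for $i\neq j$ and $a_i(t_i)=-1$, and let $\omega:\widehat H\times\widehat H\to k^*$ be the bicharacter with $\omega(a_i,a_j)=-1$ if $i<j$ and $\omega(a_i,a_j)=1$ if $i\geq j$. Let $J=\sum_{\alpha,\beta\in\widehat H}\omega(\alpha,\beta)e_\alpha\otimes e_\beta$. Then $(k\mathbb S_{2n})^J$ is simple as a Hopf algebra.
   Context: $k$ is an algebraically closed field of characteristic zero. For a twist $J$ in a Hopf algebra $A$, $A^J$ is the Hopf algebra with the same algebra and counit, comultiplication $\Delta^J(h)=J^{-1}\Delta(h)J$ and twisted antipode. For an abelian subgroup $H$ of a finite group $G$, $\widehat H$ is its character group and $e_\chi=\frac{1}{|H|}\sum_{h\in H}\chi(h^{-1})h$; for a 2-cocycle $\omega$ on $\widehat H$, $J=\sum\omega(\alpha,\beta)e_\alpha\otimes e_\beta$ is a twist in $kG$. A Hopf algebra is simple if it has no normal Hopf subalgebras (stable under ${}^hx=\sum h_1xS(h_2)$) other than $k$ and itself. *)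

(* Defs.v *)
From HB Require Import structures.
From mathcomp Require Import all_boot all_order all_algebra all_fingroup.
From Stdlib Require Import ClassicalEpsilon.
Set Implicit Arguments. Unset Strict Implicit. Unset Printing Implicit Defensive.
Import GRing.Theory.
Local Open Scope ring_scope.

Section GroupAlgebra.
Variables (gT : finGroupType) (k : fieldType).

(* kG : an element is its coefficient function on the basis G. *)
Definition galg := {ffun gT -> k^o}.
(* kG (x) kG identified with k[G x G]: coefficient function on basis g (x) h. *)
Definition galg2 := {ffun (gT * gT) -> k^o}.

Definition gbase (g : gT) : galg := [ffun x => (x == g)%:R].
Definition gone : galg := gbase 1%g.
Definition gmul (a b : galg) : galg :=
  [ffun x => \sum_(y : gT) a y * b (y^-1 * x)%g].
Definition gmul2 (a b : galg2) : galg2 :=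
  [ffun x => \sum_(y : gT * gT) a y * b ((y.1^-1 * x.1)%g, (y.2^-1 * x.2)%g)].
Definition gone2 : galg2 := [ffun x => ((x.1 == 1%g) && (x.2 == 1%g))%:R].
Definition gtensor (a b : galg) : galg2 := [ffun x => a x.1 * b x.2].
Definition gcomul (a : galg) : galg2 :=
  [ffun x => if x.1 == x.2 then a x.1 else 0].
Definition gantipode (a : galg) : galg := [ffun x => a x^-1%g].
Definition gmulmap (t : galg2) : galg :=
  [ffun x => \sum_(y : gT) t (y, (y^-1 * x)%g)].
Definition gantipode_l (t : galg2) : galg2 := [ffun x => t (x.1^-1%g, x.2)].

(* the inverse of an invertible element (chosen; unique when it exists) *)
Definition ginv (a : galg) : galg :=
  epsilon (inhabits 0) (fun b => gmul b a = gone /\ gmul a b = gone).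
Definition ginv2 (a : galg2) : galg2 :=
  epsilon (inhabits 0) (fun b => gmul2 b a = gone2 /\ gmul2 a b = gone2).

(* Twisted Hopf algebra (kG)^J: same algebra and counit,
   Delta^J(h) = J^-1 Delta(h) J, and antipode S^J(h) = Q^-1 S(h) Q with
   Q = m (S (x) id)(J). *)
Variable J : galg2.
Definition tw_comul (a : galg) : galg2 := gmul2 (gmul2 (ginv2 J) (gcomul a)) J.
Definition tw_Q : galg := gmulmap (gantipode_l J).
Definition tw_antipode (a : galg) : galg :=
  gmul (gmul (ginv tw_Q) (gantipode a)) tw_Q.

Definition vtensor (B : {vspace galg}) : {vspace galg2} :=
  <<[seq gtensor u v | u <- vbasis B, v <- vbasis B]>>%VS.

Definition tw_hopf_subalg (B : {vspace galg}) : Prop :=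
  [/\ gone \in B,
      (forall x y, x \in B -> y \in B -> gmul x y \in B),
      (forall x, x \in B -> tw_comul x \in vtensor B) &
      (forall x, x \in B -> tw_antipode x \in B)].

Definition tw_ad (h x : galg) : galg :=
  \sum_(p : gT * gT)
     tw_comul h p *: gmul (gmul (gbase p.1) x) (tw_antipode (gbase p.2)).

Definition tw_normal (B : {vspace galg}) : Prop :=
  forall h x, x \in B -> tw_ad h x \in B.

Definition tw_simple : Prop :=
  forall B : {vspace galg}, tw_hopf_subalg B -> tw_normal B ->
    B = <[gone]>%VS \/ B = fullv.

End GroupAlgebra.

Section Data.
Variable n : nat.

Lemma lo_proof (i : 'I_n) : (i.*2 < n.*2)%N.
Proof. by rewrite ltn_double. Qed.
Lemma hi_proof (i : 'I_n) : (i.*2.+1 < n.*2)%N.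
Proof. by rewrite -doubleS leq_double. Qed.

(* the points 2i-1, 2i (1-based) are lo i, hi i (0-based) *)
Definition lo (i : 'I_n) : 'I_(n.*2) := Ordinal (lo_proof i).
Definition hi (i : 'I_n) : 'I_(n.*2) := Ordinal (hi_proof i).

Definition tt (i : 'I_n) : {perm 'I_(n.*2)} := tperm (lo i) (hi i).
Definition HH : {set {perm 'I_(n.*2)}} := <<[set tt i | i : 'I_n]>>%g.

Variable k : fieldType.
(* a_i in \hat H : a_i(t_j) = 1 (j <> i), a_i(t_i) = -1; evaluated on h in H *)
Definition achar (i : 'I_n) (h : {perm 'I_(n.*2)}) : k :=
  if h (lo i) == lo i then 1 else -1.
(* \hat H = { prod_i a_i^(c_i) | c in {0,1}^n }, indexed by c *)
Definition hchar (c : {ffun 'I_n -> bool}) (h : {perm 'I_(n.*2)}) : k :=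
  \prod_(i | c i) achar i h.
Definition omega0 (i j : 'I_n) : k := if (i < j)%N then -1 else 1.
Definition omega (c d : {ffun 'I_n -> bool}) : k :=
  \prod_(i | c i) \prod_(j | d j) omega0 i j.
Definition echar (c : {ffun 'I_n -> bool}) : galg {perm 'I_(n.*2)} k :=
  [ffun g => if g \in HH then (#|HH|%:R)^-1 * hchar c g^-1 else 0].
Definition JJ : galg2 {perm 'I_(n.*2)} k :=
  \sum_(c : {ffun 'I_n -> bool}) \sum_(d : {ffun 'I_n -> bool})
     omega c d *: gtensor (echar c) (echar d).
End Data.

(* Main.v *)
Require Import Defs.
From HB Require Import structures.
From mathcomp Require Import all_boot all_order all_algebra all_fingroup all_solvable.
From Stdlib Require Import ClassicalEpsilon.

(** Write [J] as the sum of the [E_c (x) h_c] with [h_c] in [H] an involution.  Because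
    [J] lives on [H x H], the coefficient at [1] is still a Haar functional for the
    twisted coproduct; it is therefore nondegenerate on a Hopf subalgebra [B], and [B]
    contains a two-sided integral [e].  Its counit is nonzero, since otherwise [e] would
    be a square-zero element with nonzero trace in the regular representation.
    Normality of [B] forces the normalized [e] to be central in the group algebra.  Then
    [J] cancels from [Delta^J(e) (e (x) 1) = e (x) e], so [e] is the averaging idempotent
    of a normal subgroup [N].  If [N = 1] then [B] is trivial; if [N] is the whole group
    then [Delta^J(e)], a member of [B (x) B], has full rank.  In the only other case
    [N] is the alternating group, the sign agrees with the counit on [B], and evaluating
    either leg of the coproduct at the sign shows that [t_1 ... t_n] commutes with [B]
    (this needs [n] even); it then centralizes [N], which is absurd. *)

Set Implicit Arguments. Unset Strict Implicit. Unset Printing Implicit Defensive.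
Import GRing.Theory.
Local Open Scope ring_scope.
Local Notation "a '(x)' b" := (gtensor a b : galg (_ * _)%type _) (at level 40).

(** * The group algebra as an algebra *)

Section GroupAlgebraRing.
Variables (gT : finGroupType) (k : fieldType).
Local Notation A := (galg gT k).
Implicit Types (a b c : A) (g h x y : gT).

Lemma gmulA : associative (@gmul gT k).
Proof.
move=> a b c; apply/ffunP=> x; rewrite !ffunE.
under eq_bigr => y _.
  rewrite ffunE mulr_sumr (reindex_inj (mulgI y^-1%g)) /=.
  under eq_bigr => z _ do rewrite invMg invgK mulgA -(mulgA z^-1%g) mulgV mulg1 mulrA.
  over.
rewrite exchange_big; apply: eq_bigr => z _ /=.
by rewrite ffunE mulr_suml.
Qed.

Lemma gmul1l : left_id (@gone gT k) (@gmul gT k).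
Proof.
move=> a; apply/ffunP=> x; rewrite !ffunE (bigD1 1%g) //= !ffunE eqxx mul1r.
rewrite invg1 mul1g big1 ?addr0 // => y /negPf y1.
by rewrite !ffunE y1 mul0r.
Qed.

Lemma gmul1r : right_id (@gone gT k) (@gmul gT k).
Proof.
move=> a; apply/ffunP=> x; rewrite !ffunE (bigD1 x) //= !ffunE mulVg eqxx mulr1.
rewrite big1 ?addr0 // => y yx.
by rewrite !ffunE -eq_mulVg1 (negPf yx) mulr0.
Qed.

Lemma gmulDl : left_distributive (@gmul gT k) +%R.
Proof.
move=> a b c; apply/ffunP=> x; rewrite !ffunE -big_split.
by apply: eq_bigr => y _; rewrite ffunE mulrDl.
Qed.

Lemma gmulDr : right_distributive (@gmul gT k) +%R.
Proof.
move=> a b c; apply/ffunP=> x; rewrite !ffunE -big_split.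
by apply: eq_bigr => y _; rewrite ffunE mulrDr.
Qed.

Lemma gone_neq0 : gone gT k != 0.
Proof. by apply/eqP=> /ffunP/(_ 1%g)/eqP; rewrite !ffunE eqxx oner_eq0. Qed.

HB.instance Definition _ := GRing.Lmodule.copy (galg gT k) {ffun gT -> k^o}.
HB.instance Definition _ := GRing.Zmodule_isNzRing.Build (galg gT k)
  gmulA gmul1l gmul1r gmulDl gmulDr gone_neq0.

Lemma gscaleAl (u : k) a b : u *: (a * b) = (u *: a) * b.
Proof.
apply/ffunP=> x; rewrite !ffunE /GRing.scale/= mulr_sumr.
by apply: eq_bigr => y _; rewrite ffunE mulrA.
Qed.

Lemma gscaleAr (u : k) a b : u *: (a * b) = a * (u *: b).
Proof.
apply/ffunP=> x; rewrite !ffunE /GRing.scale/= mulr_sumr.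
by apply: eq_bigr => y _; rewrite ffunE mulrCA.
Qed.

HB.instance Definition _ := GRing.Lmodule_isLalgebra.Build k (galg gT k) gscaleAl.
HB.instance Definition _ := GRing.Lalgebra_isAlgebra.Build k (galg gT k) gscaleAr.
HB.instance Definition _ := Vector.copy (galg gT k) {ffun gT -> k^o}.
End GroupAlgebraRing.

(** Holds by conversion, so $kG\otimes kG$ inherits the ring structure of the group algebra of
    $G\times G$. *)
Lemma gmul2E (gT : finGroupType) (k : fieldType) (a b : galg2 gT k) :
  gmul2 a b = (a : galg (gT * gT)%type k) * (b : galg (gT * gT)%type k).
Proof. by []. Qed.

Lemma gone2E (gT : finGroupType) (k : fieldType) : gone2 gT k = 1 :> galg (gT * gT)%type k.
Proof. by apply/ffunP=> -[x y]; rewrite !ffunE. Qed.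

(** * Coefficients, linear functionals and tensors in $kG$ *)

Section GroupAlgebraTheory.
Variables (gT : finGroupType) (k : fieldType).
Local Notation A := (galg gT k).
Local Notation A2 := (galg (gT * gT)%type k).
Local Notation gb := (@gbase gT k).
Implicit Types (a b c : A) (g h x y : gT) (w : gT -> k).

Lemma gbaseM x y : gb (x * y)%g = gb x * gb y.
Proof.
apply/ffunP=> z; rewrite !ffunE (bigD1 x) //= !ffunE eqxx mul1r big1 ?addr0.
  by rewrite -[in RHS](inj_eq (mulgI x)) mulKVg.
by move=> t /negPf tx; rewrite !ffunE tx mul0r.
Qed.

Lemma gbase1 : gb 1%g = 1. Proof. by []. Qed.

Lemma galgE a : a = \sum_g a g *: gb g.
Proof.
apply/ffunP=> x; rewrite sum_ffunE (bigD1 x) //= !ffunE eqxx big1 ?addr0.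
  by rewrite /GRing.scale /= mulr1.
by move=> y yx; rewrite !ffunE eq_sym (negPf yx) scaler0.
Qed.

Lemma mulbE g a x : (gb g * a) x = a (g^-1 * x)%g.
Proof.
rewrite ffunE (bigD1 g) //= big1 ?addr0 ?ffunE ?eqxx ?mul1r // => y /negPf yg.
by rewrite ffunE yg mul0r.
Qed.

Lemma mulEb g a x : (a * gb g) x = a (x * g^-1)%g.
Proof.
rewrite ffunE (bigD1 (x * g^-1)%g) //= big1 ?addr0.
  by rewrite ffunE invMg invgK mulgKV eqxx mulr1.
move=> y yx; rewrite ffunE; case: eqP => [e|_]; last by rewrite mulr0.
by case/eqP: yx; rewrite -e invMg invgK mulKVg.
Qed.

(** The trace property of the Haar functional; it lets one-sided pairing arguments be used on both
    sides. *)
Lemma coef1C a b : (a * b) 1%g = (b * a) 1%g.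
Proof.
rewrite !ffunE (reindex_inj invg_inj); apply: eq_bigr => y _ /=.
by rewrite invgK mulg1 mulrC mulg1.
Qed.

Definition linext w a : k := \sum_g a g * w g.
Lemma linext_linear w : scalar (linext w).
Proof.
move=> u a b; rewrite /linext mulr_sumr -big_split; apply: eq_bigr => g _ /=.
by rewrite !ffunE mulrDl mulrA.
Qed.

HB.instance Definition _ w := GRing.isLinear.Build k A k *%R (linext w) (linext_linear w).

Lemma linext_base w g : linext w (gb g) = w g.
Proof.
rewrite /linext (bigD1 g) //= ffunE eqxx mul1r big1 ?addr0 // => y /negPf yg.
by rewrite ffunE yg mul0r.
Qed.

Lemma linextM w a b : (forall x y, w (x * y)%g = w x * w y) ->
  linext w (a * b) = linext w a * linext w b.
Proof.
move=> wM; rewrite {1}[a]galgE mulr_suml linear_sum {2}/linext mulr_suml.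
apply: eq_bigr => g _; rewrite -scalerAl linearZ /= -mulrA; congr (_ * _).
rewrite {1}[b]galgE mulr_sumr linear_sum /linext mulr_sumr; apply: eq_bigr => h _.
by rewrite -scalerAr linearZ /= -gbaseM linext_base wM mulrCA.
Qed.

Local Notation S := (@gantipode gT k).
Lemma gantipode_linear : linear S.
Proof. by move=> u a b; apply/ffunP=> x; rewrite !ffunE. Qed.

HB.instance Definition _ := GRing.isLinear.Build k A A *:%R S gantipode_linear.

Lemma gantipode_base g : S (gb g) = gb g^-1%g.
Proof. by apply/ffunP=> x; rewrite !ffunE -(inj_eq invg_inj) invgK. Qed.

Lemma gantipodeM a b : S (a * b) = S b * S a.
Proof.
apply/ffunP=> x; rewrite !ffunE (reindex_inj (mulgI x^-1%g)) /=.
apply: eq_bigr => y _.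
by rewrite !ffunE mulrC !invMg !invgK -mulgA mulgV mulg1.
Qed.

Lemma gantipodeK a : S (S a) = a.
Proof. by apply/ffunP=> x; rewrite !ffunE invgK. Qed.

(** [rslice] and [lslice] are $\mathrm{id}\otimes w$ and $w\otimes\mathrm{id}$, for [w] extended
    linearly to $kG$. *)
Definition rslice w (t : A2) : A := [ffun x => \sum_y t (x, y) * w y].
Definition lslice w (t : A2) : A := [ffun y => \sum_x t (x, y) * w x].
Lemma rslice_linear w : linear (rslice w).
Proof.
move=> u a b; apply/ffunP=> x; rewrite !ffunE /GRing.scale/= mulr_sumr -big_split.
by apply: eq_bigr => y _; rewrite !ffunE mulrDl mulrA.
Qed.

HB.instance Definition _ w := GRing.isLinear.Build k A2 A *:%R (rslice w) (rslice_linear w).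
Lemma lslice_linear w : linear (lslice w).
Proof.
move=> u a b; apply/ffunP=> x; rewrite !ffunE /GRing.scale/= mulr_sumr -big_split.
by apply: eq_bigr => y _; rewrite !ffunE mulrDl mulrA.
Qed.

HB.instance Definition _ w := GRing.isLinear.Build k A2 A *:%R (lslice w) (lslice_linear w).

Lemma rslice_tensor w a b : rslice w (a (x) b) = linext w b *: a.
Proof.
apply/ffunP=> x; rewrite !ffunE /GRing.scale/= mulr_suml; apply: eq_bigr => y _.
by rewrite ffunE /= -mulrA mulrC.
Qed.

Lemma lslice_tensor w a b : lslice w (a (x) b) = linext w a *: b.
Proof.
apply/ffunP=> x; rewrite !ffunE /GRing.scale/= mulr_suml; apply: eq_bigr => y _.
by rewrite ffunE /= mulrAC.
Qed.

Lemma tensorM a b a' b' : (a (x) b) * (a' (x) b') = (a * a') (x) (b * b').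
Proof.
apply/ffunP=> -[x y]; rewrite !ffunE /= big_distrlr /= pair_bigA /=.
by apply: eq_bigr => -[u v] _; rewrite !ffunE /= mulrACA.
Qed.

Lemma tensor1 : (1 : A) (x) 1 = 1.
Proof. by apply/ffunP=> -[x y]; rewrite !ffunE /= -natrM mulnb. Qed.

Lemma tensor_suml (I : finType) (F : I -> A) b : (\sum_i F i) (x) b = \sum_i (F i (x) b).
Proof.
apply/ffunP=> x; rewrite sum_ffunE ffunE sum_ffunE mulr_suml.
by apply: eq_bigr => i _; rewrite ffunE.
Qed.

Lemma tensor_sumr (I : finType) (F : I -> A) a : a (x) (\sum_i F i) = \sum_i (a (x) F i).
Proof.
apply/ffunP=> x; rewrite sum_ffunE ffunE sum_ffunE mulr_sumr.
by apply: eq_bigr => i _; rewrite ffunE.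
Qed.

Lemma tensorZl u a b : (u *: a) (x) b = u *: (a (x) b).
Proof. by apply/ffunP=> x; rewrite !ffunE /GRing.scale /= mulrA. Qed.

Lemma tensorZr u a b : a (x) (u *: b) = u *: (a (x) b).
Proof. by apply/ffunP=> x; rewrite !ffunE /GRing.scale /= mulrCA. Qed.

Lemma tensorr0 a : a (x) 0 = 0.
Proof. by apply/ffunP=> x; rewrite !ffunE mulr0. Qed.

Lemma gcomul_base g : gcomul (gb g) = gb g (x) gb g :> A2.
Proof.
apply/ffunP=> -[x y]; rewrite !ffunE /=; case: (eqVneq x y) => [->|xy].
  by case: eqP; rewrite ?mulr1 ?mulr0.
by case: (eqVneq x g) => [<-|]; rewrite ?mul0r // eq_sym (negPf xy) mulr0.
Qed.

Lemma gcomulE a : gcomul a = \sum_g a g *: (gb g (x) gb g) :> A2.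
Proof.
apply/ffunP=> -[x y]; rewrite sum_ffunE ffunE /= (bigD1 x) //= big1 ?addr0 => [|g gx].
  rewrite !ffunE /= eqxx mul1r eq_sym /GRing.scale /=.
  by case: eqP; rewrite ?mulr1 ?mulr0.
by rewrite !ffunE /= eq_sym (negPf gx) mul0r scaler0.
Qed.

(** The left legs stay in a fixed basis, so that its freeness can be applied to them; the scalars
    are absorbed in the right legs. *)
Lemma vtensorP (B : {vspace A}) (t : A2) : (t : galg2 gT k) \in vtensor B ->
  exists2 v : 'I_(\dim B) -> A, (forall i, v i \in B) &
    t = \sum_(i < \dim B) (vbasis B)`_i (x) v i.
Proof.
set X := vbasis B; rewrite /vtensor.
set Y := [seq _ | _ <- _, _ <- _] => /(@coord_span _ _ _ (in_tuple Y)) tE.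
have {tE}: exists c : 'I_(size Y) -> k, t = \sum_(i < size Y) c i *: (tnth (in_tuple Y) i : A2).
  exists (fun i => coord (in_tuple Y) i t); rewrite {1}tE.
  by apply: eq_bigr => i _; rewrite (tnth_nth 0).
case=> c {t}->.
elim/big_ind: _ => [|t1 t2 [v1 v1B ->] [v2 v2B ->]|i _].
- exists (fun=> 0) => [i|]; first exact: mem0v.
  by rewrite big1 // => i _; rewrite tensorr0.
- exists (fun i => v1 i + v2 i) => [i|]; first by rewrite memvD.
  rewrite -big_split; apply: eq_bigr => i _ /=.
  by apply/ffunP=> x; rewrite !ffunE mulrDr.
have /allpairsP[[x y] /= [xX yX ->]] := mem_tnth i (in_tuple Y).
have /tnthP[j xj] := xX.
exists (fun j' => if j' == j then c i *: y else 0) => [j'|].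
  by case: eqP => _; rewrite ?mem0v // memvZ // (vbasis_mem yX).
rewrite (bigD1 j) //= eqxx big1 ?addr0 => [|j' /negPf ->].
  by rewrite tensorZr xj (tnth_nth 0).
by rewrite tensorr0.
Qed.

End GroupAlgebraTheory.

(** * Twisting by involutions of an abelian subgroup *)

(** Only the specification of the chosen inverse is available: a left inverse $b$ of an involution
    $a$ satisfies $b=baa=a$. *)
Lemma ginv_involution (gT : finGroupType) (k : fieldType) (a : galg gT k) :
  a * a = 1 -> ginv a = a.
Proof.
move=> aa; have [/= h1 _] : gmul (ginv a) a = gone gT k /\ gmul a (ginv a) = gone gT k.
  exact: (epsilon_spec _ (fun b => gmul b a = gone gT k /\ gmul a b = gone gT k)
            (ex_intro _ a (conj aa aa))).
have := congr1 (fun b : galg gT k => b * a) (h1 : ginv a * a = 1).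
by rewrite -mulrA aa mulr1 mul1r.
Qed.

Lemma ginv2_involution (gT : finGroupType) (k : fieldType) (a : galg (gT * gT)%type k) :
  a * a = 1 -> ginv2 a = a.
Proof.
move=> aa; have [/= h1 _] : gmul2 (ginv2 a) a = gone2 gT k /\ gmul2 a (ginv2 a) = gone2 gT k.
  apply: (epsilon_spec _ (fun b => gmul2 b a = gone2 gT k /\ gmul2 a b = gone2 gT k)).
  by exists a; rewrite gmul2E gone2E.
have := congr1 (fun b : galg (gT * gT)%type k => b * a) h1.
by rewrite gmul2E gone2E -mulrA aa mulr1 mul1r.
Qed.

(** Write $M=CR$ with $C$ of full column rank and $R$ of full row rank. Then $CRCR=0$ forces $RC=0$,
    and $RC$ has the same trace as $M$. *)
Lemma mxtrace_sqr0 (F : fieldType) n (M : 'M[F]_n) : M *m M = 0 -> \tr M = 0.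
Proof.
move=> M2; rewrite -(mulmx_base M) mxtrace_mulC.
rewrite (_ : row_base M *m col_base M = 0) ?mxtrace0 //.
apply: (row_full_inj (col_base_full M)); rewrite mulmx0.
apply: (row_free_inj (row_base_free M)); rewrite mul0mx -[RHS]M2.
by rewrite -[in RHS](mulmx_base M) !mulmxA.
Qed.

(** Left multiplication by $a$ on $kG$ has matrix [M], whose trace is $|G|\,a(1)$. *)
Lemma sqr0_coef1 (gT : finGroupType) (k : fieldType) (a : galg gT k) :
  [pchar k] =i pred0 -> a * a = 0 -> a 1%g = 0.
Proof.
move=> ch aa; pose M := \matrix_(i < #|gT|, j < #|gT|) a (enum_val i * (enum_val j)^-1)%g.
have : \tr M = 0.
  apply: mxtrace_sqr0; apply/matrixP=> i j; rewrite !mxE.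
  have := congr1 (fun b : galg gT k => b (enum_val i * (enum_val j)^-1)%g) aa.
  rewrite /= !ffunE => aa0; rewrite -[RHS]aa0.
  (* The substitution $y=g_ig_l^{-1}$ turns the convolution into the matrix product. *)
  rewrite [RHS](reindex (fun l : 'I_#|gT| => (enum_val i * (enum_val l)^-1)%g)) /=.
    by apply: eq_bigr => l _; rewrite !mxE; congr (_ * a _); rewrite invMg invgK mulgA mulgKV.
  exists (fun x => enum_rank (x^-1 * enum_val i)%g) => [l|x] _.
    by rewrite invMg invgK mulgKV enum_valK.
  by rewrite enum_rankK invMg invgK mulKVg.
rewrite /mxtrace; under eq_bigr => i _ do rewrite mxE mulgV.
rewrite sumr_const card_ord -mulr_natr => /eqP; rewrite mulf_eq0 => /orP[/eqP//|].
by rewrite ((pcharf0P k).1 ch) -cardsT (negPf (lt0n_neq0 (cardG_gt0 [set: gT]))).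
Qed.

Section Coef.
Variables (gT : finGroupType) (k : fieldType).
Implicit Types a b : galg gT k.
Lemma galg_subE a b (x : gT) : (a - b) x = a x - b x.
Proof. by rewrite !ffunE. Qed.

Lemma galg_scaleE u a (x : gT) : (u *: a) x = u * a x.
Proof. by rewrite !ffunE. Qed.
End Coef.

(** * The twist $J=\sum_i E_i\otimes h_i$ and its Hopf structure *)

Section Twist.
Variables (gT : finGroupType) (k : fieldType) (H : {group gT}) (I : finType).
Local Notation A := (galg gT k).
Local Notation A2 := (galg (gT * gT)%type k).
Local Notation gb := (@gbase gT k).
Local Notation S := (@gantipode gT k).
Variables (E : I -> A) (hh : I -> gT).
Implicit Types (a b c : A) (g h x y : gT) (w : gT -> k).

Hypothesis abH : abelian H.
Hypothesis hhH : forall i, hh i \in H.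
Hypothesis hh2 : forall i, (hh i * hh i = 1)%g.
Hypothesis EH : forall i x, x \notin H -> E i x = 0.
Hypothesis EM : forall i j, E i * E j = if i == j then E i else 0.
(** [E1] and [Eeps] are the two counit normalizations $(\mathrm{id}\otimes\varepsilon)(J)=1$ and
    $(\varepsilon\otimes\mathrm{id})(J)=1$. *)
Hypothesis E1 : \sum_i E i = 1.
Hypothesis ES : forall i, S (E i) = E i.
Hypothesis Eeps : \sum_i linext (fun=> 1) (E i) *: gb (hh i) = 1.

Definition twistJ : A2 := \sum_i (E i (x) gb (hh i)).
Definition twistQ : A := \sum_i E i * gb (hh i).
Local Notation hb i := (gb (hh i)).

Lemma hhV i : ((hh i)^-1 = hh i)%g.
Proof. by apply/eqP; rewrite eq_invg_mul hh2. Qed.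

Lemma hb2 i : hb i * hb i = 1.
Proof. by rewrite -gbaseM hh2. Qed.

Lemma comHb x y : x \in H -> y \in H -> gb x * gb y = gb y * gb x.
Proof. by move=> xH yH; rewrite -!gbaseM (centsP abH _ xH _ yH). Qed.

Lemma comHE x i : x \in H -> gb x * E i = E i * gb x.
Proof.
move=> xH; rewrite [E i]galgE mulr_sumr mulr_suml; apply: eq_bigr => y _.
have [yH|yH] := boolP (y \in H); last by rewrite EH // !scale0r mulr0 mul0r.
by rewrite -scalerAl -scalerAr comHb.
Qed.

(** On the block cut out by $E_i$, [twistQ] acts as $h_i$, by orthogonality of the idempotents. *)
Lemma EQ i : E i * twistQ = E i * hb i.
Proof.
rewrite mulr_sumr (bigD1 i) //= mulrA EM eqxx big1 ?addr0 // => j.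
by rewrite eq_sym => /negPf ij; rewrite mulrA EM ij mul0r.
Qed.

Lemma comHQ x : x \in H -> gb x * twistQ = twistQ * gb x.
Proof.
move=> xH; rewrite mulr_sumr mulr_suml; apply: eq_bigr => i _.
by rewrite mulrA comHE // -!mulrA comHb.
Qed.

Lemma QE i : twistQ * E i = E i * hb i.
Proof.
rewrite mulr_suml (bigD1 i) //= -mulrA comHE // mulrA EM eqxx big1 ?addr0 // => j.
by move=> /negPf ij; rewrite -mulrA comHE // mulrA EM ij mul0r.
Qed.

Lemma twistQ2 : twistQ * twistQ = 1.
Proof.
rewrite {1}/twistQ mulr_suml -E1; apply: eq_bigr => i _.
by rewrite -mulrA comHQ // mulrA EQ -mulrA hb2 mulr1.
Qed.

Lemma gantipodeQ : S twistQ = twistQ.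
Proof.
rewrite linear_sum; apply: eq_bigr => i _ /=.
by rewrite gantipodeM gantipode_base hhV ES comHE.
Qed.

Lemma EQh i : E i * twistQ * hb i = E i.
Proof. by rewrite EQ -mulrA hb2 mulr1. Qed.

Lemma QEh i : twistQ * E i * hb i = E i.
Proof. by rewrite QE -mulrA hb2 mulr1. Qed.

Lemma hEQ i : hb i * E i * twistQ = E i.
Proof. by rewrite comHE // -mulrA comHQ // mulrA EQh. Qed.

(** Orthogonality and $h_i^2=1$ reduce the square to $\sum_i E_i\otimes 1$. Hence $\Delta^J$ is
    $J\Delta J$. *)
Lemma twistJ2 : twistJ * twistJ = 1.
Proof.
rewrite mulr_suml -tensor1 -{1}E1 tensor_suml; apply: eq_bigr => i _.
rewrite mulr_sumr (bigD1 i) //= tensorM EM eqxx hb2 big1 ?addr0 // => j ji.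
rewrite tensorM EM eq_sym (negPf ji).
by apply/ffunP=> x; rewrite !ffunE mul0r.
Qed.

(** The antipode in $m(S\otimes\mathrm{id})(J)$ disappears because it fixes every $E_i$. *)
Lemma tw_QE : tw_Q twistJ = twistQ.
Proof.
apply/ffunP=> x; rewrite ffunE /twistQ sum_ffunE.
under eq_bigr => y _ do rewrite ffunE sum_ffunE.
rewrite exchange_big; apply: eq_bigr => i _ /=.
rewrite ffunE; apply: eq_bigr => y _; rewrite ffunE /=; congr (_ * _).
by rewrite -{2}ES ffunE.
Qed.

Local Notation Sj := (tw_antipode twistJ).
Definition twD a : A2 := tw_comul twistJ a.
Local Notation D := twD.

Lemma SjE a : Sj a = twistQ * S a * twistQ.
Proof. by rewrite /tw_antipode tw_QE ginv_involution // twistQ2. Qed.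

Lemma Sj_linear : linear Sj.
Proof. by move=> u a b; rewrite !SjE linearP mulrDr mulrDl -scalerAr -scalerAl. Qed.

HB.instance Definition _ := GRing.isLinear.Build k A A *:%R Sj Sj_linear.

Lemma SjK a : Sj (Sj a) = a.
Proof.
by rewrite !SjE !gantipodeM gantipodeK gantipodeQ !mulrA twistQ2 mul1r -mulrA twistQ2 mulr1.
Qed.

Lemma DJ a : D a = twistJ * gcomul a * twistJ.
Proof. by rewrite /D /tw_comul ginv2_involution // twistJ2. Qed.

Lemma D_base g : D (gb g) = \sum_i \sum_j (E i * gb g * E j) (x) (gb (hh i * g * hh j)%g).
Proof.
rewrite DJ gcomul_base /twistJ !mulr_suml; apply: eq_bigr => i _.
by rewrite mulr_sumr; apply: eq_bigr => j _; rewrite !tensorM !gbaseM.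
Qed.

Lemma DE a : D a = \sum_g a g *: D (gb g).
Proof.
under eq_bigr => g _ do rewrite DJ gcomul_base.
rewrite DJ gcomulE; move: twistJ => j; rewrite mulr_sumr mulr_suml.
by apply: eq_bigr => g _; rewrite -scalerAr -scalerAl.
Qed.

Lemma rslice_DE w a : rslice w (D a) =
  \sum_g \sum_i \sum_j (a g * w (hh i * g * hh j)%g) *: (E i * gb g * E j).
Proof.
rewrite DE linear_sum; apply: eq_bigr => g _; rewrite linearZ /= D_base.
rewrite linear_sum scaler_sumr; apply: eq_bigr => i _.
rewrite linear_sum scaler_sumr; apply: eq_bigr => j _.
by rewrite /= rslice_tensor linext_base scalerA.
Qed.

Lemma lslice_DE w a : lslice w (D a) =
  \sum_g \sum_i \sum_j (a g * linext w (E i * gb g * E j)) *: gb (hh i * g * hh j)%g.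
Proof.
rewrite DE linear_sum; apply: eq_bigr => g _; rewrite linearZ /= D_base.
rewrite linear_sum scaler_sumr; apply: eq_bigr => i _.
rewrite linear_sum scaler_sumr; apply: eq_bigr => j _.
by rewrite /= lslice_tensor scalerA.
Qed.

Definition haar_weight b : gT -> k := fun y => b y^-1%g.
Lemma linext_haar_weight a b : linext (haar_weight b) a = (a * b) 1%g.
Proof. by rewrite ffunE; apply: eq_bigr => y _; rewrite mulg1. Qed.

(* (id (x) lam)((1 (x) b) Delta^J(c)) = (S^J (x) lam)(Delta^J(b) (1 (x) c)), where
   lam is the coefficient at 1. *)
Lemma haar_antipode b c :
  rslice (haar_weight b) (D c) = Sj (rslice (haar_weight c) (D b)).
Proof.
rewrite !rslice_DE linear_sum exchange_big [RHS]/=.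
under [RHS]eq_bigr => g _ do rewrite linear_sum /=.
rewrite [RHS]exchange_big [RHS]/=.
under [LHS]eq_bigr => i _ do rewrite exchange_big /=.
under [RHS]eq_bigr => i _.
  under eq_bigr => g _ do rewrite linear_sum /=.
  rewrite exchange_big; over.
rewrite [RHS]exchange_big; apply: eq_bigr => i _; apply: eq_bigr => j _ /=.
(* The substitution $g\mapsto(h_igh_j)^{-1}$ exchanges the coefficients of $b$ and $c$. The indices
   were swapped on the right because the antipode reverses products. *)
have inj : injective (fun g => (hh i * g * hh j)^-1%g).
  by move=> g g' /invg_inj/mulIg/mulgI.
rewrite [RHS](reindex_inj inj); apply: eq_bigr => g _ /=.
rewrite linearZ /= SjE mulrC; congr ((_ * c _) *: _).
  by rewrite !invMg !invgK !hhV !mulgA hh2 mul1g -mulgA hh2 mulg1.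
rewrite !gantipodeM gantipode_base !ES invgK !gbaseM !mulrA QEh.
by rewrite -!mulrA (mulrA (hb j)) hEQ.
Qed.

Definition antipode_mul (t : A2) : A := \sum_p t p *: (Sj (gb p.1) * gb p.2).
Lemma antipode_mul_linear : linear antipode_mul.
Proof.
move=> u a b; rewrite /antipode_mul scaler_sumr -big_split; apply: eq_bigr => g _ /=.
by rewrite !ffunE scalerDl scalerA.
Qed.

HB.instance Definition _ := GRing.isLinear.Build k A2 A *:%R antipode_mul antipode_mul_linear.
Lemma antipode_mul_tensor a b : antipode_mul (a (x) b) = Sj a * b.
Proof.
rewrite {2}[a]galgE {2}[b]galgE linear_sum mulr_suml.
under [RHS]eq_bigr => x _ do rewrite mulr_sumr.
rewrite pair_bigA /=; apply: eq_bigr => -[x y] _ /=.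
by rewrite ffunE linearZ /= -scalerAl -scalerAr scalerA.
Qed.

(** The antipode axiom. By [EQh] the factor $E_iQh_i$ is $E_i$, so the sum over $i$ collapses and
    $g^{-1}g$ cancels; [QEh] then leaves $\sum_jE_j=1$. *)
Lemma antipode_mul_D a : antipode_mul (D a) = linext (fun=> 1) a *: 1.
Proof.
rewrite DE linear_sum scaler_suml; apply: eq_bigr => g _; rewrite linearZ /= mulr1.
congr (_ *: _); rewrite D_base linear_sum /=.
under eq_bigr => i _ do rewrite linear_sum /=.
rewrite exchange_big -E1; apply: eq_bigr => j _ /=.
transitivity (\sum_i twistQ * E j * gb g^-1%g * E i * (gb g * hb j)).
  apply: eq_bigr => i _; rewrite antipode_mul_tensor SjE !gantipodeM gantipode_base !ES.
  by rewrite !gbaseM !mulrA -(mulrA _ (E i) twistQ) -(mulrA _ (E i * twistQ) (hb i)) EQh.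
rewrite -mulr_suml -mulr_sumr E1 mulr1 mulrA -(mulrA _ (gb _) (gb g)) -gbaseM mulVg.
by rewrite gbase1 mulr1 QEh.
Qed.

(** The untwisted $(\mathrm{id}\otimes w)\Delta(a)$, written $w.a$ below. *)
Definition char_scale (w : gT -> k) a : A := [ffun g => a g * w g].
Lemma char_scaleE w a : char_scale w a = \sum_g (a g * w g) *: gb g.
Proof. by rewrite {1}[char_scale w a]galgE; apply: eq_bigr => g _; rewrite ffunE. Qed.

Lemma char_scale_sandwich w u a :
  u * char_scale w a * u = \sum_g (a g * w g) *: (u * gb g * u).
Proof.
rewrite char_scaleE mulr_sumr mulr_suml; apply: eq_bigr => g _.
by rewrite -scalerAr -scalerAl.
Qed.

(** For multiplicative [w] the map $\mathrm{id}\otimes w$ is an algebra map; it sends $J\Delta(a)J$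
    to $u\,(w.a)\,u$ with $u=(\mathrm{id}\otimes w)(J)$. The next slice lemma is the mirror image,
    with $v=(w\otimes\mathrm{id})(J)$. *)
Lemma rslice_char w a : (forall x y, w (x * y)%g = w x * w y) ->
  let u := \sum_i w (hh i) *: E i in rslice w (D a) = u * char_scale w a * u.
Proof.
move=> wM u; rewrite rslice_DE char_scale_sandwich; apply: eq_bigr => g _.
rewrite /u mulr_suml mulr_suml scaler_sumr.
apply: eq_bigr => i _; rewrite mulr_sumr scaler_sumr; apply: eq_bigr => j _.
rewrite -!scalerAl -scalerAr !scalerA; congr (_ *: _).
by rewrite !wM -!mulrA; congr (_ * _); rewrite mulrCA.
Qed.

Lemma lslice_char w a : (forall x y, w (x * y)%g = w x * w y) ->
  let v := \sum_i linext w (E i) *: hb i in lslice w (D a) = v * char_scale w a * v.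
Proof.
move=> wM v; rewrite lslice_DE char_scale_sandwich; apply: eq_bigr => g _.
rewrite /v mulr_suml mulr_suml scaler_sumr.
apply: eq_bigr => i _; rewrite mulr_sumr scaler_sumr; apply: eq_bigr => j _.
rewrite -!scalerAl -scalerAr !scalerA !gbaseM; congr (_ *: _).
by rewrite !linextM // linext_base -!mulrA; congr (_ * _); rewrite mulrCA.
Qed.

Lemma counitr a : rslice (fun=> 1) (D a) = a.
Proof.
rewrite rslice_char => [|_ _]; last by rewrite mulr1.
under eq_bigr do rewrite scale1r.
by rewrite E1 mul1r mulr1; apply/ffunP=> x; rewrite ffunE mulr1.
Qed.

Lemma counitl a : lslice (fun=> 1) (D a) = a.
Proof.
rewrite lslice_char => [|_ _]; last by rewrite mulr1.
by rewrite Eeps mul1r mulr1; apply/ffunP=> x; rewrite ffunE mulr1.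
Qed.

Definition adjoint_mul (x : A) (t : A2) : A := \sum_p t p *: (gb p.1 * x * Sj (gb p.2)).
Lemma adjoint_mul_linear (x : A) : linear (adjoint_mul x).
Proof.
move=> u a b; rewrite /adjoint_mul scaler_sumr -big_split; apply: eq_bigr => g _ /=.
by rewrite !ffunE scalerDl scalerA.
Qed.

HB.instance Definition _ (x : A) :=
  GRing.isLinear.Build k A2 A *:%R (adjoint_mul x) (adjoint_mul_linear x).
Lemma adjoint_mul_tensor (x a b : A) : adjoint_mul x (a (x) b) = a * x * Sj b.
Proof.
rewrite {2}[a]galgE {2}[b]galgE linear_sum mulr_sumr.
under [RHS]eq_bigr => v _ do rewrite !mulr_suml.
rewrite exchange_big pair_bigA /=; apply: eq_bigr => -[u v] _ /=.
by rewrite ffunE linearZ /= -!scalerAl -scalerAr scalerA.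
Qed.

Lemma tw_adE g (x : A) : tw_ad twistJ (gb g) x =
  \sum_i \sum_j E i * gb g * (E j * x * twistQ * hb j) * gb g^-1%g * hb i * twistQ.
Proof.
rewrite -[LHS]/(adjoint_mul x (D (gb g))) D_base linear_sum; apply: eq_bigr => i _.
rewrite linear_sum; apply: eq_bigr => j _ /=; rewrite adjoint_mul_tensor SjE gantipode_base.
by rewrite !invMg !hhV !gbaseM !mulrA.
Qed.

(** Elements of $H$ commute with the legs of $J$ and with $Q$, so on them the twist changes neither
    the coproduct nor the antipode. *)
Lemma tw_ad_H g (x : A) : g \in H -> tw_ad twistJ (gb g) x = gb g * x * gb g^-1%g.
Proof.
move=> gH; rewrite tw_adE -[in RHS](mul1r x) -E1 mulr_suml mulr_sumr mulr_suml.
apply: eq_bigr => i _; rewrite (bigD1 i) //= big1 ?addr0 => [|j ji].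
  rewrite -(comHE _ gH) !mulrA -(mulrA _ (E i) (E i)) EM eqxx -!mulrA.
  do 3!congr (_ * _).
  have cg := comHb (groupVr gH) (hhH i).
  rewrite (mulrA (gb _) (hb i)) cg !mulrA -(mulrA twistQ) hb2 mulr1.
  by rewrite -(comHQ (groupVr gH)) -mulrA twistQ2 mulr1.
by rewrite -(comHE _ gH) !mulrA -(mulrA _ (E i) (E j)) EM eq_sym (negPf ji) mulr0 !mul0r.
Qed.

(* ad_g is the conjugate by theta of the ordinary conjugation by g. *)
Definition theta (y : A) : A := \sum_i E i * y * hb i * twistQ.
Lemma thetaK (y : A) : theta (theta y) = y.
Proof.
rewrite -[RHS]mul1r -E1 mulr_suml; apply: eq_bigr => i _.
rewrite /theta mulr_sumr !mulr_suml (bigD1 i) //= big1 ?addr0 => [|j ji].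
  rewrite !mulrA EM eqxx -!mulrA (mulrA twistQ (hb i)) -(comHQ (hhH i)).
  by rewrite -!mulrA twistQ2 mulr1 hb2 mulr1.
by rewrite !mulrA EM eq_sym (negPf ji) !mul0r.
Qed.

Lemma eps_sumE : \sum_i linext (fun=> 1) (E i) = 1.
Proof. by rewrite -linear_sum /= E1 linext_base. Qed.

Lemma mul11 : forall x y : gT, 1 = 1 * 1 :> k. Proof. by move=> _ _; rewrite mulr1. Qed.

Lemma eps_theta (y : A) : linext (fun=> 1) (theta y) = linext (fun=> 1) y.
Proof.
rewrite linear_sum /=; under eq_bigr => i _.
  rewrite !(linextM _ _ mul11) linext_base mulr1 -mulrA; over.
rewrite -mulr_suml eps_sumE mul1r linear_sum /=.
under eq_bigr => i _ do rewrite (linextM _ _ mul11) linext_base mulr1.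
by rewrite eps_sumE mulr1.
Qed.

(** * The integral of a normal Hopf subalgebra *)

Section NormalHopfSubalgebra.
Variable B : {vspace A}.
Hypotheses (hopfB : tw_hopf_subalg twistJ B) (normB : tw_normal twistJ B).
Hypothesis char0 : [pchar k] =i pred0.
Local Notation eps := (linext (fun _ : gT => 1 : k)).
Local Notation X := (vbasis B).

Lemma B1 : 1 \in B. Proof. by case: hopfB. Qed.

Lemma BM a b : a \in B -> b \in B -> a * b \in B.
Proof. by case: hopfB => _ + _ _; apply. Qed.

Lemma BS a : a \in B -> Sj a \in B.
Proof. by case: hopfB => _ _ _; apply. Qed.

Lemma BD a : a \in B -> exists2 v : 'I_(\dim B) -> A, (forall i, v i \in B) &
    D a = \sum_(i < \dim B) X`_i (x) v i.
Proof. by case: hopfB => _ _ BDa _ /BDa/vtensorP. Qed.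

Lemma BX (i : 'I_(\dim B)) : X`_i \in B.
Proof. by apply: vbasis_mem; rewrite mem_nth ?size_tuple. Qed.

(* The radical of the form (b, c) |-> (bc)(1) is a left coideal by haar_antipode, and
   eps vanishes on it by the antipode axiom; the counit axiom then kills it. *)
Lemma haar_nondeg b : b \in B -> (forall c, c \in B -> (b * c) 1%g = 0) -> b = 0.
Proof.
have step b' : b' \in B -> (forall c, c \in B -> (b' * c) 1%g = 0) ->
  forall v : 'I_(\dim B) -> A, D b' = \sum_(i < \dim B) X`_i (x) v i ->
  forall i c, c \in B -> (v i * c) 1%g = 0.
  move=> b'B Ib' v Dv i c cB; have [z zB Dz] := BD cB.
  (* The left side vanishes since its right legs lie in [B]. The antipode is injective and the basis
     is free, so every coefficient on the right vanishes. *)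
  have := haar_antipode b' c; rewrite Dv Dz !linear_sum /=.
  rewrite big1 => [e|j _]; last by rewrite rslice_tensor linext_haar_weight coef1C Ib' ?scale0r.
  have /freeP fX := basis_free (vbasisP B).
  apply: (fX (fun j => (v j * c) 1%g)); apply: (can_inj SjK).
  rewrite linear0 [RHS]e linear_sum.
  by apply: eq_bigr => j _; rewrite rslice_tensor linext_haar_weight.
have eps0 b' : b' \in B -> (forall c, c \in B -> (b' * c) 1%g = 0) -> eps b' = 0.
  move=> b'B Ib'; have [v vB Dv] := BD b'B.
  (* The coefficient at 1 of the antipode axiom expresses $\varepsilon(b')$ through pairings of the
     $v_i$ with [B]. *)
  have := congr1 (fun a : A => a 1%g) (antipode_mul_D b').
  rewrite /= Dv linear_sum /= sum_ffunE big1 => [|i _].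
    by rewrite !ffunE eqxx /GRing.scale /= mulr1.
  by rewrite antipode_mul_tensor coef1C (step _ b'B Ib' _ Dv) ?BS ?BX.
move=> bB Ib; have [v vB Dv] := BD bB.
rewrite -(counitr b) Dv linear_sum /= big1 // => i _.
by rewrite rslice_tensor eps0 ?scale0r // => c cB; apply: (step _ bB Ib _ Dv).
Qed.

(** Nondegeneracy makes the Gram matrix of the basis invertible; its inverse, applied to the counits
    of the basis, gives the coordinates of [l]. *)
Lemma haar_dual : exists2 l, l \in B & forall b, b \in B -> (b * l) 1%g = eps b.
Proof.
pose G := \matrix_(i < \dim B, j < \dim B) (X`_i * X`_j) 1%g.
have G_unit : G \in unitmx.
  rewrite -row_free_unit; apply: inj_row_free => u uG.
  have /freeP fX := basis_free (vbasisP B).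
  apply/rowP=> i; rewrite mxE; apply: (fX (u 0)) => {i}; apply: haar_nondeg.
    by apply: memv_suml => i _; rewrite memvZ ?BX.
  move=> c /coord_vbasis ->; rewrite mulr_sumr sum_ffunE big1 // => j _.
  rewrite -scalerAr ffunE mulr_suml sum_ffunE.
  have /rowP/(_ j) := uG; rewrite !mxE => e.
  rewrite (_ : \sum_i _ = 0) ?scaler0 // -[RHS]e; apply: eq_bigr => i _.
  by rewrite mxE -scalerAl ffunE.
pose r := invmx G *m (\col_i eps X`_i).
exists (\sum_(j < \dim B) r j 0 *: X`_j).
  by apply: memv_suml => j _; rewrite memvZ ?BX.
move=> b /coord_vbasis ->; rewrite mulr_suml sum_ffunE linear_sum.
apply: eq_bigr => i _; rewrite linearZ /= -scalerAl ffunE; congr (_ * _).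
have <- : (G *m r) i 0 = eps X`_i by rewrite mulKVmx // mxE.
rewrite mulr_sumr sum_ffunE [RHS]mxE; apply: eq_bigr => j _.
by rewrite [G _ _]mxE -scalerAr ffunE mulrC.
Qed.

Lemma epsM a b : eps (a * b) = eps a * eps b.
Proof. by rewrite (linextM _ _ mul11). Qed.

Lemma eps1 : eps (1 : A) = 1.
Proof. by rewrite linext_base. Qed.

(** Pairing $bl-\varepsilon(b)l$ with any $c$ gives
    $\varepsilon(cb)-\varepsilon(b)\varepsilon(c)=0$, so nondegeneracy makes [l] a left integral;
    the trace property handles the right side. *)
Lemma integral_exists : exists e, [/\ e \in B, eps e = 1,
  forall b, b \in B -> b * e = eps b *: e & forall b, b \in B -> e * b = eps b *: e].
Proof.
have [l lB lP] := haar_dual.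
have bl b : b \in B -> b * l = eps b *: l.
  move=> bB; apply/eqP; rewrite -subr_eq0; apply/eqP/haar_nondeg.
    by rewrite memvB ?BM ?memvZ.
  move=> c cB; rewrite coef1C mulrBr mulrA galg_subE -scalerAr galg_scaleE !lP ?BM //.
  by rewrite epsM mulrC subrr.
have lb b : b \in B -> l * b = eps b *: l.
  move=> bB; apply/eqP; rewrite -subr_eq0; apply/eqP/haar_nondeg.
    by rewrite memvB ?BM ?memvZ.
  move=> c cB; rewrite mulrBl -mulrA galg_subE -scalerAl galg_scaleE !(coef1C l) !lP ?BM //.
  by rewrite epsM subrr.
(* The dual property at 1 gives $l(1)=1$, whereas $\varepsilon(l)=0$ would give $l^2=0$. *)
have l0 : eps l != 0.
  apply/eqP=> l0; have := lP _ B1; rewrite mul1r eps1 sqr0_coef1 ?bl ?l0 ?scale0r //.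
  by apply/eqP; rewrite eq_sym oner_eq0.
exists ((eps l)^-1 *: l); split.
- by rewrite memvZ.
- by rewrite linearZ /= mulVf.
- by move=> b bB; rewrite -scalerAr bl // !scalerA mulrC.
- by move=> b bB; rewrite -scalerAl lb // !scalerA mulrC.
Qed.

(** Both sides equal $geg^{-1}eg$. *)
Lemma conj_fixed (e : A) g :
  e * (gb g^-1%g * e * gb g) = e -> (gb g * e * gb g^-1%g) * e = e ->
  gb g * e = e * gb g.
Proof.
move=> e1 e2; have := congr1 (fun a => gb g * a) e1 => <- /=.
by rewrite -[in RHS]e2 !mulrA.
Qed.

(** * Centrality and support of the integral *)

Section Integral.
Variable e : A.
Hypotheses (eB : e \in B) (epse : eps e = 1).
Hypotheses (Be : forall b, b \in B -> b * e = eps b *: e)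
           (eb : forall b, b \in B -> e * b = eps b *: e).

Lemma eps_conj g a : eps (gb g * a * gb g^-1%g) = eps a.
Proof. by rewrite !epsM !linext_base mul1r mulr1. Qed.

(** The conjugates of $e$ by $H$ are twisted adjoint images, hence lie in [B] and are absorbed by
    $e$ on either side. *)
Lemma integral_comH g : g \in H -> gb g * e = e * gb g.
Proof.
have cB x : x \in H -> gb x * e * gb x^-1%g \in B.
  by move=> xH; rewrite -tw_ad_H // normB.
move=> gH; apply: conj_fixed.
  have := eb (cB _ (groupVr gH)).
  by rewrite eps_conj epse scale1r invgK.
by rewrite Be ?cB // eps_conj epse scale1r.
Qed.

Lemma integral_comE i : e * E i = E i * e.
Proof.
rewrite [E i]galgE mulr_sumr mulr_suml; apply: eq_bigr => y _.
have [yH|yH] := boolP (y \in H); last by rewrite EH // !scale0r mulr0 mul0r.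
by rewrite -scalerAl -scalerAr integral_comH.
Qed.

Lemma integral_comQ : e * twistQ = twistQ * e.
Proof.
rewrite mulr_sumr mulr_suml; apply: eq_bigr => i _.
by rewrite mulrA integral_comE -!mulrA integral_comH.
Qed.

Lemma thetaMl (y : A) : theta (e * y) = e * theta y.
Proof. by rewrite mulr_sumr; apply: eq_bigr => i _; rewrite !mulrA integral_comE. Qed.

Lemma thetaMr (y : A) : theta (y * e) = theta y * e.
Proof.
rewrite mulr_suml; apply: eq_bigr => i _.
by rewrite -!mulrA -integral_comQ (mulrA e) -integral_comH // !mulrA.
Qed.

Lemma theta_integral : theta e = e.
Proof.
rewrite -{1}(mulr1 e) thetaMl -[RHS]mulr1 -[X in _ = _ * X]E1; congr (_ * _).
by apply: eq_bigr => i _; rewrite mulr1 -mulrA comHQ // mulrA EQh.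
Qed.

(** Since $e$ commutes with $E_j$, the sum over $j$ collapses to $e$. *)
Lemma tw_ad_integral g : tw_ad twistJ (gb g) e = theta (gb g * e * gb g^-1%g).
Proof.
rewrite tw_adE; apply: eq_bigr => i _.
rewrite -!mulr_suml -mulr_sumr; do 2!congr (_ * _); rewrite -!mulrA; congr (_ * (_ * _)).
congr (_ * _); rewrite -[RHS]mulr1 -E1 mulr_sumr; apply: eq_bigr => j _.
by rewrite -integral_comE -!mulrA (mulrA (E j)) EQh.
Qed.

(** Normality puts [theta] of each conjugate of $e$ in [B], where $e$ absorbs it. As [theta] is
    injective, fixes $e$ and commutes with multiplication by $e$, the conjugates themselves are
    absorbed. *)
Lemma integral_central g : gb g * e = e * gb g.
Proof.
have tB x : theta (gb x * e * gb x^-1%g) \in B by rewrite -tw_ad_integral normB.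
have tinj := can_inj thetaK.
have teps x : eps (theta (gb x * e * gb x^-1%g)) = 1 by rewrite eps_theta eps_conj.
apply: conj_fixed; apply: tinj.
  by rewrite -{2}(invgK g) thetaMl eb // teps scale1r theta_integral.
by rewrite thetaMr Be // teps scale1r theta_integral.
Qed.

(** This is the coefficient at $(x,y)$ of $\Delta(e)(e\otimes 1)=e\otimes e$. *)
Lemma integral_group_like x y : e x * e y = e y * e (y^-1 * x)%g.
Proof.
have ce a : e * a = a * e.
  rewrite [a]galgE mulr_sumr mulr_suml; apply: eq_bigr => g _.
  by rewrite -scalerAl -scalerAr integral_central.
have [v vB De] := BD eB.
(* The left legs of $\Delta^J(e)$ lie in [B] and act on $e$ by the counit. *)
have : D e * (e (x) 1) = e (x) e.
  rewrite -[X in _ = e (x) X](counitl e) De mulr_suml linear_sum tensor_sumr.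
  apply: eq_bigr => i _.
  by rewrite tensorM mulr1 Be ?BX //= lslice_tensor tensorZl tensorZr.
have JC b : (forall c, b * c = c * b) -> twistJ * (e (x) b) = (e (x) b) * twistJ.
  move=> cb; rewrite mulr_suml mulr_sumr; apply: eq_bigr => i _.
  by rewrite !tensorM ce cb.
rewrite DJ -(mulrA _ twistJ (_ (x) _)) JC => [|c]; last by rewrite mul1r mulr1.
(* As $e$ is central, $J$ commutes with $e\otimes 1$ and $e\otimes e$, and multiplying by $J$ on
   both sides removes the twist. *)
move/(congr1 (fun t => twistJ * t * twistJ)).
rewrite (JC e ce) !mulrA twistJ2 mul1r -!mulrA twistJ2 !mulr1.
move/(congr1 (fun t : A2 => t (x, y))); rewrite /= [RHS]ffunE /= => <-.
rewrite gcomulE mulr_suml sum_ffunE (bigD1 y) //= big1 ?addr0 => [|z zy].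
  by rewrite -scalerAl tensorM mulr1 galg_scaleE ffunE /= mulbE ffunE eqxx mulr1.
by rewrite -scalerAl tensorM mulr1 galg_scaleE ffunE /= [gbase _ _ y]ffunE eq_sym (negPf zy) !mulr0.
Qed.

(** Left translation by a point of the support preserves $e$, so the support is a subgroup on which
    $e$ is constant; centrality makes it normal. *)
Lemma integral_support : exists (N : {group gT}) (c : k),
  [/\ (N <| [set: gT])%g, forall x, e x = if x \in N then c else 0 & c != 0].
Proof.
have [y0 ey0] : exists y, e y != 0.
  apply/existsP; rewrite -[[exists _, _]]negbK negb_exists; apply/negP=> /forallP e0.
  suff e00 : e = 0 by have := epse; rewrite e00 linear0 => /eqP; rewrite eq_sym oner_eq0.
  by apply/ffunP=> x; rewrite ffunE; apply/eqP; rewrite -[_ == _]negbK e0.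
have eM y z : e y != 0 -> e (y * z)%g = e z.
  move=> ey; have := integral_group_like (y * z) y.
  by rewrite mulKg mulrC => /(mulfI ey).
have e1 : e 1%g != 0 by rewrite -(eM _ _ ey0) mulg1.
have gN : group_set [set x | e x != 0].
  by apply/group_setP; split=> [|x y]; rewrite !inE // => ex ey; rewrite eM.
exists (group gN), (e 1%g); split=> // [|x].
  apply/normalP; split; first exact: subsetT.
  move=> g _; apply/setP=> x; rewrite mem_conjg !inE; congr (_ != _).
  by rewrite /conjg -mulbE integral_central mulEb invgK mulgKV.
by rewrite inE; case: eqP => [-> //|/eqP ex] /=; rewrite -{1}(mulg1 x) eM.
Qed.

(** * What the support of the integral says about $B$ *)

Section Support.
Variables (N : {group gT}) (c : k).
Hypotheses (eN : forall x, e x = if x \in N then c else 0) (c0 : c != 0).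

Lemma rslice_B w b : b \in B -> rslice w (D b) \in B.
Proof.
move=> bB; have [v vB ->] := BD bB; rewrite linear_sum memv_suml // => i _.
by rewrite /= rslice_tensor memvZ ?BX.
Qed.

(** Here $e=1$, so $b=be=\varepsilon(b)1$ for every $b$ in [B]. *)
Lemma trivial_support : N :=: 1%g -> B = <[gone gT k]>%VS.
Proof.
move=> N1; have ee : e = c *: (1 : A).
  by apply/ffunP=> x; rewrite galg_scaleE ffunE eN N1 inE; case: (x == 1%g); rewrite ?mulr1 ?mulr0.
have {}ee : e = 1.
  by have := epse; rewrite ee linearZ /= eps1 mulr1 => ->; rewrite scale1r.
apply/eqP; rewrite eqEsubv; apply/andP; split; apply/subvP=> b.
  move=> /Be; rewrite ee mulr1 => ->.
  by rewrite memvZ // memv_line.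
by case/vlineP=> u ->; rewrite memvZ // B1.
Qed.

(** Here $e$ is a multiple of the sum of all group elements. The slices of $\Delta^J(e)$ give every
    $QxQ$, and these span $kG$ because $Q^2=1$. *)
Lemma full_support : N :=: [set: gT] -> B = fullv.
Proof.
move=> NT; have eT x : e x = c by rewrite eN NT inE.
have QB x : twistQ * gb x * twistQ \in B.
  have := rslice_B (fun y => (y == x)%:R) eB; rewrite rslice_DE.
  suff -> : \sum_g \sum_i \sum_j (e g * (hh i * g * hh j == x)%g%:R) *: (E i * gb g * E j)
     = c *: (twistQ * gb x * twistQ).
    by move=> sB; have := memvZ c^-1 sB; rewrite scalerA mulVf // scale1r.
  rewrite exchange_big /= /twistQ !mulr_suml scaler_sumr; apply: eq_bigr => i _.
  rewrite mulr_sumr scaler_sumr exchange_big; apply: eq_bigr => j _ /=.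
  rewrite (bigD1 (hh i * x * hh j)%g) //= big1 ?addr0 => [|g gN].
    rewrite eT !mulgA hh2 mul1g -(mulgA x) hh2 mulg1 eqxx mulr1 !gbaseM !mulrA.
    by rewrite -!mulrA comHE.
  case: eqP => [e0|_]; last by rewrite mulr0 scale0r.
  by case/eqP: gN; rewrite -e0 !mulgA hh2 mul1g -mulgA hh2 mulg1.
have QaB a : twistQ * a * twistQ \in B.
  move: twistQ QB => q qB; rewrite [a]galgE mulr_sumr mulr_suml memv_suml // => g _.
  by rewrite -scalerAr -scalerAl memvZ.
apply/eqP; rewrite eqEsubv subvf /=; apply/subvP=> a _.
by have := QaB (twistQ * a * twistQ); rewrite !mulrA twistQ2 mul1r -mulrA twistQ2 mulr1.
Qed.

(** $J$ commutes with $t\otimes 1$, so commutation of $t$ with the left legs of $\Delta^J(e)$ passes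
    to the untwisted $\Delta(e)$. *)
Lemma central_support t : t \in H -> (forall b, b \in B -> gb t * b = b * gb t) ->
  t \in 'C(N)%g.
Proof.
move=> tH tB; apply/centP=> g gN.
have JC y : y \in H -> twistJ * (gb y (x) 1) = (gb y (x) 1) * twistJ.
  move=> yH; rewrite mulr_suml mulr_sumr; apply: eq_bigr => i _.
  by rewrite !tensorM mulr1 mul1r comHE.
have : (gb t (x) 1) * D e = D e * (gb t (x) 1).
  have [v vB ->] := BD eB; rewrite mulr_suml mulr_sumr; apply: eq_bigr => i _.
  by rewrite !tensorM mul1r mulr1 tB ?BX.
rewrite DJ -(mulrA _ twistJ (_ (x) _)) (JC _ tH) !mulrA -(JC _ tH).
move/(congr1 (fun s => twistJ * s * twistJ)).
rewrite !mulrA twistJ2 !mul1r -!mulrA twistJ2 !mulr1.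
(* At this point the left side is $c$, while the right side is $c$ if $tg=gt$ and $0$ otherwise. *)
move/(congr1 (fun s : A2 => s ((t * g)%g, g))).
rewrite /= gcomulE mulr_suml mulr_sumr !sum_ffunE.
have off (f : gT -> A) : \sum_z (e z *: (f z (x) gb z)) (t * g, g)%g = e g * f g (t * g)%g.
  rewrite (bigD1 g) //= big1 ?addr0 => [|z zg].
    by rewrite galg_scaleE ffunE /= [gb _ g]ffunE eqxx mulr1.
  by rewrite galg_scaleE ffunE /= [gb _ g]ffunE eq_sym (negPf zg) !mulr0.
under eq_bigr => z _ do rewrite -scalerAr tensorM -gbaseM mul1r.
under [RHS]eq_bigr => z _ do rewrite -scalerAl tensorM -gbaseM mulr1.
rewrite !off !ffunE eqxx mulr1 eN gN.
by case: eqP => [//|_] /eqP; rewrite mulr0 (negPf c0).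
Qed.

(* As w(e) = 1 = eps(e) and b e = eps(b) e on B, the functionals w and eps agree
   on B.  Hence applying w instead of eps to one leg of Delta^J(b) still returns b,
   which reads b = u (w.b) u = v (w.b) v. *)
Lemma char_support (w : gT -> k) t :
  (forall x y, w (x * y)%g = w x * w y) -> (forall x, x \in N -> w x = 1) ->
  t \in H ->
  (\sum_i linext w (E i) *: hb i) * (\sum_i w (hh i) *: E i) = gb t ->
  t \in 'C(N)%g.
Proof.
move=> wM wN tH vu; apply: central_support => // b.
have we : linext w e = 1.
  rewrite -epse; apply: eq_bigr => x _; rewrite eN.
  by case: ifP => [/wN->|_] //; rewrite !mul0r.
have wB b' : b' \in B -> linext w b' = eps b'.
  move=> /Be/(congr1 (linext w)); rewrite linextM // we mulr1 linearZ /= we => ->.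
  by rewrite mulr1.
have rB b' : b' \in B -> rslice w (D b') = b'.
  move=> b'B; rewrite -[RHS]counitr; have [v vB ->] := BD b'B.
  rewrite !linear_sum; apply: eq_bigr => i _.
  by rewrite /= !rslice_tensor wB.
have lB b' : b' \in B -> lslice w (D b') = b'.
  move=> b'B; rewrite -[RHS]counitl; have [v vB ->] := BD b'B.
  rewrite !linear_sum; apply: eq_bigr => i _.
  by rewrite /= !lslice_tensor wB ?BX.
move: vu; set u := \sum_i w _ *: _; set v := \sum_i _ => vu.
have {}rB b' : b' \in B -> u * char_scale w b' * u = b' by move=> /rB; rewrite rslice_char.
have {}lB b' : b' \in B -> v * char_scale w b' * v = b' by move=> /lB; rewrite lslice_char.
have w1 : char_scale w 1 = 1.
  have w1 : w 1%g = 1 by rewrite wN.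
  by apply/ffunP=> x; rewrite !ffunE; case: eqP => [->|_]; rewrite ?w1 ?mulr1 ?mul0r.
have u2 : u * u = 1 by have := rB _ B1; rewrite w1 mulr1.
have v2 : v * v = 1 by have := lB _ B1; rewrite w1 mulr1.
(* Both $vu\,b$ and $b\,vu$ reduce to $v\,(w.b)\,u$. *)
move=> bB; rewrite -vu -{1}(rB b bB) -{2}(lB b bB) !mulrA.
by rewrite -(mulrA v u u) u2 mulr1 -!mulrA (mulrA v v) v2 mul1r.
Qed.

End Support.
End Integral.

(** The integral is eliminated from the statement. The product in the last clause is
    $(w\otimes\mathrm{id})(J)\,(\mathrm{id}\otimes w)(J)$. *)
Lemma normal_hopf_support : exists N : {group gT},
  [/\ (N <| [set: gT])%g, N :=: 1%g -> B = <[gone gT k]>%VS,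
      N :=: [set: gT] -> B = fullv &
      forall (w : gT -> k) t,
        (forall x y, w (x * y)%g = w x * w y) -> (forall x, x \in N -> w x = 1) ->
        t \in H ->
        (\sum_i linext w (E i) *: hb i) * (\sum_i w (hh i) *: E i) = gb t ->
        t \in 'C(N)%g].
Proof.
have [e [eB epse Be eb]] := integral_exists.
have [N [c [nN eN c0]]] := integral_support eB epse Be eb.
exists N; split=> //.
- exact: trivial_support eN.
- exact: full_support eN c0.
- exact: char_support eN c0.
Qed.

End NormalHopfSubalgebra.

End Twist.

(** * The twist of the symmetric group *)

Section Swaps.
Variable n : nat.
Local Notation G := {perm 'I_(n.*2)}.
Local Notation V := {ffun 'I_n -> bool}.
Implicit Types (s c d : V) (i j : 'I_n).

Lemma lo_inj : injective (@lo n).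
Proof. by move=> i j /(congr1 val)/= /double_inj/val_inj. Qed.

Lemma hi_inj : injective (@hi n).
Proof. by move=> i j /(congr1 val)/= [] /double_inj/val_inj. Qed.

Lemma lo_hi i j : lo i == hi j = false.
Proof. by apply/negP=> /eqP/(congr1 (fun x : 'I__ => odd x))/=; rewrite !odd_double. Qed.

Lemma lo_or_hi (x : 'I_(n.*2)) : exists j, x = lo j \/ x = hi j.
Proof.
have xn : (x./2 < n)%N by rewrite ltn_half_double.
exists (Ordinal xn); have := odd_double_half x; case: (odd x) => /= e.
  by right; apply: val_inj; rewrite /= -[LHS]e.
by left; apply: val_inj; rewrite /= -[LHS]e.
Qed.

Lemma tt_lo i j : tt i (lo j) = if i == j then hi j else lo j.
Proof.
have [->|ij] := eqVneq; first by rewrite tpermL.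
by rewrite tpermD // ?(inj_eq lo_inj) // eq_sym lo_hi.
Qed.

Lemma tt_hi i j : tt i (hi j) = if i == j then lo j else hi j.
Proof.
have [->|ij] := eqVneq; first by rewrite tpermR.
by rewrite tpermD // ?(inj_eq hi_inj) // lo_hi.
Qed.

Definition swaps s : G := (\prod_(i | s i) tt i)%g.

(** Stated for duplicate-free lists so that induction applies; only the factor [tt j] moves [lo j]
    and [hi j]. *)
Lemma prod_ttE (r : seq 'I_n) s j : uniq r ->
  ((\prod_(i <- r | s i) tt i)%g (lo j) = if (j \in r) && s j then hi j else lo j) /\
  ((\prod_(i <- r | s i) tt i)%g (hi j) = if (j \in r) && s j then lo j else hi j).
Proof.
elim: r => [|i r IH] /=; first by rewrite !big_nil !perm1.
case/andP=> ir /IH[IHl IHh]; rewrite !big_cons !inE.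
have [ij|ij] := eqVneq j i.
  move: IHl IHh; rewrite ij (negPf ir) /= => IHl IHh.
  by case: (s i); rewrite ?permM ?tt_lo ?tt_hi ?eqxx IHl IHh.
by case: (s i); rewrite ?permM ?tt_lo ?tt_hi 1?eq_sym ?(negPf ij) IHl IHh.
Qed.

Lemma swaps_lo s j : swaps s (lo j) = if s j then hi j else lo j.
Proof.
by have [-> _] := prod_ttE s j (index_enum_uniq _); rewrite mem_index_enum.
Qed.

Lemma swaps_hi s j : swaps s (hi j) = if s j then lo j else hi j.
Proof.
by have [_ ->] := prod_ttE s j (index_enum_uniq _); rewrite mem_index_enum.
Qed.

Definition fxor s c : V := [ffun i => s i (+) c i].
Lemma fxorr s : fxor s s = [ffun=> false].
Proof. by apply/ffunP=> i; rewrite !ffunE addbb. Qed.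

Lemma fxorK s : involutive (fxor s).
Proof. by move=> c; apply/ffunP=> i; rewrite !ffunE addKb. Qed.

Lemma swapsM s c : (swaps s * swaps c)%g = swaps (fxor s c).
Proof.
apply/permP=> x; rewrite permM; have [j [->|->]] := lo_or_hi x.
  by rewrite !swaps_lo !ffunE; case: (s j) => /=; rewrite ?swaps_lo ?swaps_hi; case: (c j).
by rewrite !swaps_hi !ffunE; case: (s j) => /=; rewrite ?swaps_lo ?swaps_hi; case: (c j).
Qed.

Lemma swaps0 : swaps [ffun=> false] = 1%g.
Proof. by rewrite /swaps big1 // => i; rewrite ffunE. Qed.

Lemma swapsV s : ((swaps s)^-1 = swaps s)%g.
Proof. by apply/eqP; rewrite eq_invg_mul swapsM fxorr swaps0. Qed.

Lemma swaps_inj : injective swaps.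
Proof.
move=> s c e; apply/ffunP=> i; have := congr1 (fun g : G => g (lo i) == lo i) e.
by rewrite /= !swaps_lo; case: (s i); case: (c i); rewrite ?eqxx // eq_sym lo_hi.
Qed.

Definition swap_group : {group G} := <<[set tt i | i : 'I_n]>>%G.
Lemma swap_groupE : swap_group :=: HH n. Proof. by []. Qed.

Lemma in_HH g : (g \in HH n) = (g \in codom swaps).
Proof.
apply/idP/codomP=> [|[s ->]]; last first.
  by rewrite -swap_groupE; apply: group_prod => i _; apply/mem_gen/imset_f.
have gK : group_set [set swaps s | s : V].
  apply/group_setP; split; first by rewrite -swaps0 imset_f.
  by move=> _ _ /imsetP[s _ ->] /imsetP[c _ ->]; rewrite swapsM imset_f.
have : HH n \subset group gK.
  rewrite gen_subG; apply/subsetP=> _ /imsetP[i _ ->].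
  apply/imsetP; exists [ffun j => j == i] => //.
  by rewrite /swaps (big_pred1 i) // => j; rewrite ffunE.
by move/subsetP=> sub /sub/imsetP[s _ ->]; exists s.
Qed.

Lemma in_swap_group g : (g \in swap_group) = (g \in codom swaps).
Proof. exact: in_HH. Qed.

Lemma swap_group_abelian : abelian swap_group.
Proof.
apply/centsP=> x; rewrite in_swap_group => /codomP[s ->] y.
rewrite in_swap_group => /codomP[c ->]; rewrite /commute !swapsM; congr swaps.
by apply/ffunP=> i; rewrite !ffunE addbC.
Qed.

Lemma swaps_in s : swaps s \in swap_group.
Proof. by rewrite in_swap_group codom_f. Qed.

Lemma card_HH : #|HH n| = (2 ^ n)%N.
Proof.
by rewrite (eq_card in_HH) (card_codom swaps_inj) card_ffun card_bool card_ord.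
Qed.

Lemma odd_swaps s : odd_perm (swaps s) = odd (\sum_i s i).
Proof.
rewrite /swaps big_mkcond /=.
elim/big_ind2: _ => [|x a y b xa yb|i _]; rewrite ?odd_perm1 //.
  by rewrite odd_permM xa yb oddD.
case: (s i); rewrite ?odd_perm1 // odd_tperm.
by rewrite lo_hi.
Qed.
End Swaps.

(** * Characters of $H$ and the legs of $J$ *)

Section Characters.
Variables (n : nat) (k : fieldType).
Local Notation G := {perm 'I_(n.*2)}.
Local Notation V := {ffun 'I_n -> bool}.
Local Notation gb := (@gbase G k).
Implicit Types (s c d : V) (i j : 'I_n).
Hypothesis char0 : [pchar k] =i pred0.

(** The symmetric pairing $(-1)^{c\cdot s}$ on bit vectors, through which characters and elements of
    $H$ share one index set. *)
Definition chi c s : k := \prod_i (-1) ^+ (c i && s i).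
Lemma chiC c s : chi c s = chi s c.
Proof. by apply: eq_bigr => i _; rewrite andbC. Qed.

Lemma chiDr c s d : chi c (fxor s d) = chi c s * chi c d.
Proof.
rewrite -big_split; apply: eq_bigr => i _; rewrite /= ffunE -signr_addb.
by rewrite andb_addr.
Qed.

Lemma chi_sign (c s : V) : chi c s = (-1) ^+ (\sum_i (c i && s i))%N.
Proof. by rewrite expr_sum. Qed.

Lemma hchar_swaps c s : hchar k c (swaps s) = chi c s.
Proof.
rewrite /hchar big_mkcond; apply: eq_bigr => i _; case: (c i) => //=.
rewrite /achar swaps_lo; case: (s i); rewrite ?eqxx //.
by rewrite eq_sym lo_hi.
Qed.

Lemma two_neq0 : 2%:R != 0 :> k.
Proof. by rewrite ((pcharf0P k).1 char0). Qed.

(** The sum factors over the coordinates, with factor 2 where $c_i=0$ and $1-1=0$ where $c_i=1$. *)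
Lemma sum_chi c : \sum_s chi c s = if c == [ffun=> false] then 2 ^+ n else 0.
Proof.
rewrite -(bigA_distr_bigA (fun i (b : bool) => (-1) ^+ (c i && b) : k)) /=.
have sb (b : bool) : \sum_(x : bool) (-1) ^+ (b && x) = if b then 0 else 2%:R :> k.
  by rewrite big_bool; case: b; rewrite /= ?expr0 ?expr1 ?addNr.
under eq_bigr => i _ do rewrite sb.
case: eqP => [->|/eqP c0].
  under eq_bigr => i _ do rewrite ffunE.
  by rewrite prodr_const card_ord.
have [i ci] : exists i, c i.
  apply/existsP; apply: contraNT c0; rewrite negb_exists => /forallP c0.
  by apply/eqP/ffunP=> i; rewrite ffunE; apply: negbTE.
by rewrite (bigD1 i) //= ci mul0r.
Qed.

Local Notation q := ((2 ^+ n : k)^-1).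
Local Notation E c := (echar k c : galg G k).
Lemma q_neq0 : (2 ^+ n : k) != 0. Proof. by rewrite expf_neq0 // two_neq0. Qed.

Lemma echarE c : E c = \sum_s (q * chi c s) *: gb (swaps s).
Proof.
apply/ffunP=> g; rewrite ffunE sum_ffunE in_HH.
have [/codomP[s ->]|gH] := boolP (g \in codom (@swaps n)).
  rewrite (bigD1 s) //= big1 ?addr0 => [|d ds].
    by rewrite galg_scaleE ffunE eqxx mulr1 swapsV hchar_swaps card_HH natrX.
  by rewrite galg_scaleE ffunE (inj_eq (@swaps_inj n)) eq_sym (negPf ds) mulr0.
rewrite big1 // => s _; rewrite galg_scaleE ffunE; case: eqP => [e|_]; last by rewrite mulr0.
by case/negP: gH; rewrite e codom_f.
Qed.

Lemma mul_swaps_echar s c : gb (swaps s) * E c = chi c s *: E c.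
Proof.
rewrite echarE mulr_sumr scaler_sumr (reindex_inj (can_inj (@fxorK n s))).
apply: eq_bigr => d _ /=; rewrite -scalerAr -gbaseM swapsM fxorK scalerA chiDr.
by rewrite mulrCA.
Qed.

Lemma fxor_eq0 c d : (fxor c d == [ffun=> false]) = (c == d).
Proof.
apply/eqP/eqP=> [e|->]; last exact: fxorr.
by apply: (can_inj (fxorK c)); rewrite e fxorr.
Qed.

Lemma echarM c d : E c * E d = if c == d then E c else 0.
Proof.
rewrite {1}echarE mulr_suml.
transitivity (\sum_s (q * chi (fxor c d) s) *: E d).
  apply: eq_bigr => s _; rewrite -scalerAl mul_swaps_echar scalerA -mulrA.
  by rewrite chiC (chiC d) -chiDr chiC.
rewrite -scaler_suml -mulr_sumr sum_chi fxor_eq0; case: eqP => [->|_].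
  by rewrite mulVf ?q_neq0 // scale1r.
by rewrite mulr0 scale0r.
Qed.

Lemma sum_echar : \sum_c E c = 1.
Proof.
under eq_bigr => c _ do rewrite echarE.
rewrite exchange_big (bigD1 [ffun=> false]) //= [X in _ + X]big1 ?addr0 => [|s s0].
  rewrite -scaler_suml -mulr_sumr; under eq_bigr => c _ do rewrite chiC.
  by rewrite sum_chi eqxx mulVf ?q_neq0 // scale1r swaps0.
rewrite -scaler_suml -mulr_sumr; under eq_bigr => c _ do rewrite chiC.
by rewrite sum_chi (negPf s0) mulr0 scale0r.
Qed.

Lemma gantipode_echar c : gantipode (E c) = E c.
Proof.
apply/ffunP=> g; rewrite !ffunE -swap_groupE groupV swap_groupE in_HH.
by case: ifP => [/codomP[s ->]|//]; rewrite invgK swapsV.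
Qed.

Lemma echar_out c g : g \notin swap_group n -> E c g = 0.
Proof. by rewrite ffunE swap_groupE => /negPf ->. Qed.

(** Fourier inversion: $s$ acts on the block of $c$ by the scalar $\chi_c(s)$. *)
Lemma sum_chi_echar s : \sum_c chi c s *: E c = gb (swaps s).
Proof.
by under eq_bigr => c _ do rewrite -mul_swaps_echar; rewrite -mulr_sumr sum_echar mulr1.
Qed.

Lemma linext_echar (w : G -> k) d : (forall s, w (swaps s) = chi d s) ->
  forall c, linext w (E c) = (c == d)%:R.
Proof.
move=> wd c; rewrite echarE linear_sum.
under eq_bigr => s _ do rewrite linearZ /= linext_base wd chiC (chiC d) -mulrA -chiDr chiC.
rewrite -mulr_sumr sum_chi fxor_eq0; case: eqP => _; last by rewrite mulr0.
by rewrite mulVf ?q_neq0.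
Qed.

(** [swaps (below c)] is the element of $H$ at which the character $d$ takes the value
    $\omega(c,d)$; [above] does the same with the second argument of $\omega$ fixed. *)
Definition below c : V := [ffun j : 'I_n => odd (\sum_(i | c i) (i < j))].
Definition above c : V := [ffun i : 'I_n => odd (\sum_(j | c j) (i < j))].

Lemma omega_below c d : omega k c d = chi d (below c).
Proof.
rewrite /omega exchange_big /= big_mkcond; apply: eq_bigr => j _.
case: (d j) => //=; rewrite ffunE signr_odd -prodrXr.
by apply: eq_bigr => i _; rewrite /omega0; case: (i < j)%N.
Qed.

Lemma omega_above c d : omega k c d = chi c (above d).
Proof.
rewrite /omega big_mkcond; apply: eq_bigr => i _.
case: (c i) => //=; rewrite ffunE signr_odd -prodrXr.
by apply: eq_bigr => j _; rewrite /omega0; case: (i < j)%N.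
Qed.

Lemma JJE : JJ n k = twistJ (fun c : V => E c) (fun c => swaps (below c)).
Proof.
apply: eq_bigr => c _; rewrite -sum_chi_echar tensor_sumr; apply: eq_bigr => d _.
by rewrite tensorZr omega_below.
Qed.

End Characters.

(** * Normal subgroups of the symmetric group *)

Section NormalSubgroupsOfSym.
Local Open Scope group_scope.
Variable T : finType.
Implicit Type N : {group {perm T}}.

(** If $x$ moves $a$, then commuting with the transposition of $a$ and $c$ forces $c\in\{a,x(a)\}$,
    for every $c$. *)
Lemma perm_central_eq1 (x : {perm T}) : (2 < #|T|)%N ->
  (forall y : {perm T}, commute x y) -> x = 1.
Proof.
move=> T2 xC; apply/permP=> a; rewrite perm1; apply/eqP; apply: contraLR T2 => xa.
have sub c : c \in [set a; x a].
  rewrite !inE; have := tpermJ a c x; rewrite conjgE -(xC (tperm a c)) mulKg.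
  move/(congr1 (fun y : {perm T} => y a)); rewrite /= tpermL.
  case: tpermP => [e|_ ->|_ _ ->]; rewrite ?eqxx ?orbT //.
  by case/eqP: xa.
rewrite -leqNgt -cardsT; apply: leq_trans (_ : #|[set a; x a]| <= 2)%N.
  by apply/subset_leq_card/subsetP.
by rewrite cards2; case: eqP.
Qed.

(** If $N$ meets the simple group ['Alt_T] trivially, a commutator of an element of $N$ with any
    permutation is even and in $N$, hence trivial; so $N$ is central. *)
Lemma normal_Sym N : (4 < #|T|)%N -> N <| [set: {perm T}] ->
  N :=: 1 \/ 'Alt_T \subset N.
Proof.
move=> T4 nN; have /simpleP[_ simA] := simple_Alt5 T4.
have nNA : N :&: 'Alt_T <| 'Alt_T.
  rewrite /normal subsetIr normsI ?normG //.
  by apply: subset_trans (normal_norm nN); apply: subsetT.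
have [NA1|NA] := simA _ nNA; last by right; rewrite -NA subsetIl.
left; apply/trivgP/subsetP=> x xN; rewrite inE; apply/eqP/perm_central_eq1.
  exact: leq_trans T4.
move=> y; apply/commgP; rewrite -in_set1 -[[set 1]]NA1 inE Alt_even commgEl.
rewrite odd_permM odd_permV odd_permJ addbb andbT groupM ?groupV //.
by rewrite memJ_norm // (subsetP (normal_norm nN)) ?inE.
Qed.
End NormalSubgroupsOfSym.

(** * The sign character and simplicity *)

Section Main.
Variables (k : fieldType) (n : nat).
Hypotheses (char0 : [pchar k] =i pred0) (n2 : (2 < n)%N) (en : ~~ odd n).
Local Notation G := {perm 'I_(n.*2)}.
Local Notation V := {ffun 'I_n -> bool}.
Local Notation E c := (echar k c : galg G k).
Local Notation one := ([ffun=> true] : V).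

(* The legs of J under the sign are the products of the t_i over the i of the two
   parities; they are complementary because n is even (and equal if n is odd). *)
Lemma below_above_true : fxor (below one) (above one) = one.
Proof.
apply/ffunP=> i; rewrite !ffunE -oddD; under eq_bigl => j do rewrite ffunE.
under [X in (_ + X)%N]eq_bigl => j do rewrite ffunE.
(* Together the two counts run over all $j\neq i$; there are $n-1$ of them, an odd number. *)
rewrite -big_split /= (eq_bigr (fun j : 'I_n => (j != i) : nat)) => [|j _].
  rewrite -big_mkcond sum1_card cardC1 card_ord.
  by move: n2 en; case: (n) => //= m _; rewrite negbK.
by rewrite -val_eqE /= neq_ltn; case: ltngtP.
Qed.

Lemma swaps_true_notin_cent : swaps one \notin 'C('Alt_('I_(n.*2)))%g.
Proof.
have n0 : (0 < n)%N by apply: leq_trans n2.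
have n1 : (1 < n)%N by apply: leq_trans n2.
pose i0 := Ordinal n0; pose i1 := Ordinal n1.
(* A 3-cycle. Applying [swaps one] and then [g] fixes [lo i0]; the opposite order sends it to
   [hi i1]. *)
pose g := (tperm (lo i0) (hi i0) * tperm (hi i0) (lo i1))%g.
have i01 : lo i0 == lo i1 = false by rewrite (inj_eq (@lo_inj n)).
apply/negP=> /centP/(_ g).
rewrite Alt_even odd_permM !odd_tperm lo_hi eq_sym lo_hi => /(_ isT).
move/(congr1 (fun x : G => x (lo i0))); rewrite /= !permM.
rewrite swaps_lo ffunE tpermR tpermD ?lo_hi ?i01 // 1?eq_sym ?lo_hi ?i01 //.
rewrite tpermL tpermL swaps_lo ffunE => /eqP.
by rewrite lo_hi.
Qed.

Definition sgn_perm (g : G) : k := (-1) ^+ odd_perm g.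
Lemma sgn_permM x y : sgn_perm (x * y)%g = sgn_perm x * sgn_perm y.
Proof. by rewrite /sgn_perm odd_permM signr_addb. Qed.

Lemma sgn_swaps s : sgn_perm (swaps s) = chi k one s.
Proof.
rewrite /sgn_perm odd_swaps signr_odd chi_sign; congr (_ ^+ _).
by apply: eq_bigr => i _; rewrite ffunE.
Qed.

Lemma tw_simple_JJ : tw_simple (JJ n k).
Proof.
move=> B; rewrite JJE // => hopfB normB.
have swapsK (c : V) : (swaps (below c) * swaps (below c) = 1)%g.
  by rewrite swapsM fxorr swaps0.
have Eeps : \sum_(c : V) linext (fun=> 1) (E c) *: gbase k (swaps (below c)) = 1.
  have ev1 c : linext (fun=> 1) (E c) = (c == [ffun=> false])%:R.
    apply: linext_echar => // s; rewrite chi_sign big1 ?expr0 // => i _.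
    by rewrite ffunE.
  rewrite (bigD1 [ffun=> false]) //= ev1 eqxx scale1r big1 ?addr0 => [|c /negPf c0].
    rewrite (_ : below _ = [ffun=> false]) ?swaps0 //; apply/ffunP=> j.
    by rewrite !ffunE big1 // => i; rewrite ffunE.
  by rewrite ev1 c0 scale0r.
have [N [nN N1 NT NC]] := normal_hopf_support (@swap_group_abelian n)
  (fun c => swaps_in _) swapsK (@echar_out n k) (echarM char0) (sum_echar n char0) (@gantipode_echar n k) Eeps
  hopfB normB char0.
have T4 : (4 < #|'I_(n.*2)|)%N.
  by rewrite card_ord; apply: leq_trans (_ : 3.*2 <= _)%N; rewrite ?leq_double.
have [/N1|AN] := normal_Sym T4 nN; first by left.
right; apply: NT; apply/eqP; rewrite eqEsubset subsetT /=.
have [/subsetP NA|/subsetPn[x xN]] := boolP (N \subset ('Alt_('I_(n.*2)))%g).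
  case/negP: swaps_true_notin_cent; apply: (subsetP (centS AN)).
  apply: (NC sgn_perm) => [|||].
  - exact: sgn_permM.
  - by move=> x /NA; rewrite Alt_even /sgn_perm => /negPf ->.
  - exact: swaps_in.
  (* The sign restricts to the character [one] of $H$. Its left leg of $J$ keeps only $c$ equal to
     [one]; its right leg is recovered from $\omega(c,\mathtt{one})$ by Fourier inversion. *)
  have evE := linext_echar char0 sgn_swaps.
  rewrite (bigD1 one) //= evE eqxx scale1r big1 ?addr0 => [|c /negPf c0]; last first.
    by rewrite evE c0 scale0r.
  under eq_bigr => c _ do rewrite sgn_swaps -omega_below omega_above.
  by rewrite sum_chi_echar // -gbaseM swapsM below_above_true.
(* Now $N$ contains an odd $x$; for odd $g$ the product $gx$ is even, hence in $N$. *)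
rewrite Alt_even negbK => ox; apply/subsetP=> g _.
have [og|eg] := boolP (odd_perm g); last by rewrite (subsetP AN) // Alt_even.
rewrite -(groupMr _ xN) (subsetP AN) //.
by rewrite Alt_even odd_permM ox og.
Qed.
End Main.

Theorem theorem3p6 (k : closedFieldType) (n : nat) :
  [pchar k]%R =i pred0 -> (2 < n)%N -> ~~ odd n ->
  tw_simple (JJ n k).
Proof. exact: tw_simple_JJ. Qed.
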